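(* Let $G$ be an abelian group that is not almost divisible. Then: (a) $(G,\nu_G)^*=(G,\gamma_G)^*=t(\mathrm{Hom}(G,\mathbb T))=t(\mathrm{Hom}(G/G^1,\mathbb T))$; (b) $|\mathcal C(G)|=w(G,\gamma_G)=\chi(G,\gamma_G)=|t(\mathrm{Hom}(G,\mathbb T))|$.
   Context: $\mathbb T=\mathbb R/\mathbb Z$ with its usual compact topology. For a topological abelian group $(G,\tau)$ (not necessarily Hausdorff), $(G,\tau)^*$ is the group of all continuous characters $(G,\tau)\to\mathbb T$, viewed as a subgroup of $\mathrm{Hom}(G,\mathbb T)$, the group of all homomorphisms $G\to\mathbb T$. For an abelian group $A$, $t(A)$ is its torsion subgroup. With $\mathbb N_+$ the set of positive integers and $mG=\{mx:x\in G\}$, the first Ulm subgroup of $G$ is $G^1=\bigcap_{m\in\mathbb N_+}mG$. In (a), $\mathrm{Hom}(G/G^1,\mathbb T)$ is identified with a subgroup of $\mathrm{Hom}(G,\mathbb T)$ via composition with the canonical projection $G\to G/G^1$. $\mathcal C(G)$ is the family of all finite-index subgroups of $G$; the profinite topology $\gamma_G$ is the group topology on $G$ having $\mathcal C(G)$ as a base of neighborhoods of $0$; the natural topology $\nu_G$ is the group topology on $G$ having $\{mG:m\in\mathbb N_+\}$ as a base of neighborhoods of $0$. The weight $w$ is the minimum cardinality of a base of the topology, and the local weight $\chi$ is the minimum cardinality of a base of neighborhoods of $0$. $D(G)$ denotes the largest divisible subgroup of $G$; $G$ is almost divisible if $G/D(G)$ is finite (equivalently, if $\mathcal C(G)$ is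 finite). *)

(* Defs.v *)
From HB Require Import structures.
From mathcomp Require Import all_boot all_order all_algebra.
From mathcomp Require Import generic_quotient ring_quotient.
From mathcomp Require Import boolp classical_sets functions cardinality reals.
From mathcomp Require Import topology normedtype tvs.

Set Implicit Arguments.
Unset Strict Implicit.
Unset Printing Implicit Defensive.

Import Order.TTheory GRing.Theory Num.Theory.
Import numFieldNormedType.Exports.

Local Open Scope classical_set_scope.
Local Open Scope ring_scope.
Local Open Scope quotient_scope.
Local Open Scope card_scope.

Section HomGroup.
Variables U V : zmodType.
Implicit Types f g h : {additive U -> V}.

HB.instance Definition _ := gen_eqMixin {additive U -> V}.
HB.instance Definition _ := gen_choiceMixin {additive U -> V}.

Lemma additive_eqP f g : f =1 g -> f = g.
Proof.
case: f g => [f [[af]]] [g [[ag]]] /= /funext fg; subst g.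
by rewrite (Prop_irrelevance af ag).
Qed.

Definition hom_zero : {additive U -> V} := \0.
Definition hom_opp f : {additive U -> V} := \- f.
Definition hom_add f g : {additive U -> V} := f \+ g.

Lemma hom_addA : associative hom_add.
Proof. by move=> f g h; apply: additive_eqP => x; rewrite /= addrA. Qed.
Lemma hom_addC : commutative hom_add.
Proof. by move=> f g; apply: additive_eqP => x; rewrite /= addrC. Qed.
Lemma hom_add0 : left_id hom_zero hom_add.
Proof. by move=> f; apply: additive_eqP => x; rewrite /= add0r. Qed.
Lemma hom_addN : left_inverse hom_zero hom_opp hom_add.
Proof. by move=> f; apply: additive_eqP => x; rewrite /= addNr. Qed.

HB.instance Definition _ := GRing.isZmodule.Build {additive U -> V}
  hom_addA hom_addC hom_add0 hom_addN.

End HomGroup.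


Definition integers (R : realType) : {pred R} := [pred x | x \is a Num.int].
Arguments integers : clear implicits.

Lemma integers_zmod_closed (R : realType) : zmod_closed (integers R).
Proof. by split=> [|x y xZ yZ]; [exact: rpred0 | exact: rpredB]. Qed.

HB.instance Definition _ (R : realType) :=
  GRing.isZmodClosed.Build R (integers R) (integers_zmod_closed R).

(* T = R/Z, with the group structure of [Quotient.quot] and the quotient
   topology of [quotient_topology]. *)
Definition circle (R : realType) : Type :=
  quotient_topology (Quotient.quot (integers R)).
HB.instance Definition _ (R : realType) := Topological.on (circle R).
HB.instance Definition _ (R : realType) :=
  GRing.Zmodule.copy (circle R) (Quotient.quot (integers R)).

Section Subgroups.
Variable G : zmodType.
Implicit Types H K : set G.

Definition subgroup H := H 0 /\ forall x y, H x -> H y -> H (x - y).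

Definition coset x H : set G := [set x + h | h in H].

Definition finite_index H := finite_set [set coset x H | x in setT].

Definition fin_index_subgroups : set (set G) :=
  [set H | subgroup H /\ finite_index H].

Definition multiples m : set G := [set x *+ m | x in setT].

Definition torsion : set G := [set x | exists2 m, (0 < m)%N & x *+ m = 0].

Definition divisible H :=
  forall m x, (0 < m)%N -> H x -> exists2 y, H y & y *+ m = x.

(* D(G), obtained as the union of all divisible subgroups, which is itself a
   divisible subgroup (lemma max_divisibleP). *)
Definition max_divisible : set G :=
  \bigcup_(H in [set H | subgroup H /\ divisible H]) H.

Definition almost_divisible := finite_index max_divisible.

(* The first Ulm subgroup G^1, as a boolean predicate in order to form G/G^1. *)
Definition ulm1 : {pred G} :=
  [pred x | `[< forall m, (0 < m)%N -> multiples m x >]].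

End Subgroups.
Arguments fin_index_subgroups : clear implicits.
Arguments multiples : clear implicits.
Arguments torsion : clear implicits.
Arguments max_divisible : clear implicits.
Arguments ulm1 : clear implicits.

Section SubgroupLemmas.
Variable G : zmodType.
Implicit Types H K : set G.

Lemma subgroupN H x : subgroup H -> H x -> H (- x).
Proof. by move=> [H0 HB] Hx; rewrite -sub0r; exact: HB. Qed.

Lemma subgroupD H x y : subgroup H -> H x -> H y -> H (x + y).
Proof.
by move=> sH Hx Hy; rewrite -[y]opprK; apply: (sH.2) => //; exact: subgroupN.
Qed.

Lemma max_divisibleP :
  [/\ subgroup (max_divisible G), divisible (max_divisible G) &
      forall H, subgroup H -> divisible H -> H `<=` max_divisible G].
Proof.
split; last by move=> H sH dH x Hx; exists H.
- split=> [|x y [H [sH dH] Hx] [K [sK dK] Ky]].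
    exists [set 0] => //; split; first by split=> // x y -> ->; rewrite subr0.
    by move=> m x _ ->; exists 0; rewrite ?mul0rn.
  exists [set h + k | h in H & k in K]; last first.
    by exists x => //; exists (- y) => //; exact: subgroupN.
  split.
    split; first by exists 0; [exact: sH.1 | exists 0; rewrite ?addr0 //; exact: sK.1].
    move=> _ _ [h Hh [k Kk <-]] [h' Hh' [k' Kk' <-]].
    exists (h - h'); first exact: sH.2.
    by exists (k - k'); [exact: sK.2 | rewrite opprD addrACA].
  move=> m _ m0 [h Hh [k Kk <-]].
  have [h' Hh' <-] := dH m h m0 Hh; have [k' Kk' <-] := dK m k m0 Kk.
  by exists (h' + k'); [exists h' => //; exists k' | rewrite mulrnDl].
- move=> m x m0 [H [sH dH] Hx]; have [y Hy yx] := dH m x m0 Hx.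
  by exists y => //; exists H.
Qed.

Lemma multiples_subgroup m : subgroup (multiples G m).
Proof.
split; first by exists 0; rewrite ?mul0rn.
by move=> _ _ [x _ <-] [y _ <-]; exists (x - y); rewrite ?mulrnBl.
Qed.

Lemma ulm1_zmod_closed : zmod_closed (ulm1 G).
Proof.
split=> [|x y /asboolW xU /asboolW yU]; apply: asboolT => m m0.
  by exists 0; rewrite ?mul0rn.
by apply: (multiples_subgroup m).2; [exact: xU | exact: yU].
Qed.

HB.instance Definition _ := GRing.isZmodClosed.Build G (ulm1 G) ulm1_zmod_closed.

Lemma fin_index_setT : fin_index_subgroups G [set: G].
Proof.
split=> //; apply: (@sub_finite_set _ _ [set setT]); last exact: finite_set1.
move=> _ [x _ <-]; apply/seteqP; split=> // y _.
by exists (y - x) => //; rewrite addrC subrK.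
Qed.

Lemma coset_eq H x y : subgroup H -> H (x - y) -> coset x H = coset y H.
Proof.
move=> sH Hxy; apply/seteqP; split=> _ [h Hh <-].
  by exists (x - y + h); [exact: subgroupD | rewrite addrA (addrC y) subrK].
exists (- (x - y) + h); last by rewrite addrA opprB (addrC x) subrK.
by apply: subgroupD => //; exact: subgroupN.
Qed.

Lemma fin_index_setI H K : fin_index_subgroups _ H -> fin_index_subgroups _ K ->
  fin_index_subgroups G (H `&` K).
Proof.
move=> [sH fH] [sK fK]; split.
  split; first by split; [exact: sH.1 | exact: sK.1].
  by move=> x y [Hx Kx] [Hy Ky]; split; [exact: sH.2 | exact: sK.2].
pose F (p : set G * set G) := p.1 `&` p.2.
apply: (@sub_finite_set _ _ (F @` ([set coset x H | x in setT] `*`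
                                   [set coset x K | x in setT]))); last first.
  by apply: finite_image; exact: finite_setX.
move=> _ [x _ <-]; exists (coset x H, coset x K); first by split; exists x.
apply/seteqP; split=> [y [[h Hh <-] [k Kk /addrI kh]]|_ [h [Hh Kh] <-]].
  by exists h => //; split=> //; rewrite -kh.
by split; exists h.
Qed.

End SubgroupLemmas.

(* A group topology having a given filter base of subgroups as a base of
   neighborhoods of 0. *)
HB.factory Record isLinearTopological G & GRing.Zmodule G := {
  lin_base : set (set G);
  lin_base_neq0 : lin_base !=set0;
  lin_base_subgroup : forall H, lin_base H -> subgroup H;
  lin_base_setI : forall H K, lin_base H -> lin_base K ->
    exists2 L, lin_base L & L `<=` H `&` K
}.

HB.builders Context G & isLinearTopological G.

Definition lin_nbhs (x : G) : set_system G := filter_from lin_base (coset x).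

HB.instance Definition _ := hasNbhs.Build G lin_nbhs.

Lemma lin_nbhs_filter (x : G) : ProperFilter (nbhs x).
Proof.
apply: filter_from_proper; last first.
  by move=> H BH; exists (x + 0), 0 => //; exact: (lin_base_subgroup BH).1.
apply: filter_from_filter; first exact: lin_base_neq0.
move=> H K BH BK; have [L BL LHK] := lin_base_setI BH BK; exists L => //.
by move=> _ [h /LHK[Hh Kh] <-]; split; exists h.
Qed.

Lemma lin_nbhs_singleton (x : G) (A : set G) : nbhs x A -> A x.
Proof.
move=> [H BH HA]; apply: HA; exists 0; last by rewrite addr0.
exact: (lin_base_subgroup BH).1.
Qed.

Lemma lin_nbhs_nbhs (x : G) (A : set G) : nbhs x A -> nbhs x (nbhs^~ A).
Proof.
move=> [H BH HA]; exists H => // _ [h Hh <-]; exists H => // _ [k Hk <-].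
apply: HA; exists (h + k); last by rewrite addrA.
exact: (subgroupD (lin_base_subgroup BH)).
Qed.

HB.instance Definition _ := Nbhs_isNbhsTopological.Build G
  lin_nbhs_filter lin_nbhs_singleton lin_nbhs_nbhs.

Lemma lin_sub_continuous : continuous (fun x : G * G => x.1 - x.2).
Proof.
move=> [x y] A [H BH HA]; have sH := lin_base_subgroup BH.
exists (coset x H, coset y H); first by split; exists H.
move=> [a b] /= [[h Hh <-] [k Hk <-]]; apply: HA.
by exists (h - k); [exact: sH.2 | rewrite opprD addrACA].
Qed.

HB.instance Definition _ :=
  PreTopologicalNmodule_isTopologicalZmodule.Build G lin_sub_continuous.

HB.end.

(* [profinite G] and [natural G] are copies of the group G carrying the
   topologies gamma_G and nu_G respectively. *)
Definition profinite (G : zmodType) : Type := G.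
HB.instance Definition _ (G : zmodType) := GRing.Zmodule.on (profinite G).

Section Profinite.
Variable G : zmodType.

Lemma profinite_base_neq0 : fin_index_subgroups (profinite G) !=set0.
Proof. by exists setT; exact: fin_index_setT. Qed.

Lemma profinite_base_subgroup (H : set (profinite G)) :
  fin_index_subgroups _ H -> subgroup H.
Proof. by case. Qed.

Lemma profinite_base_setI (H K : set (profinite G)) :
  fin_index_subgroups _ H -> fin_index_subgroups _ K ->
  exists2 L, fin_index_subgroups _ L & L `<=` H `&` K.
Proof. by move=> fH fK; exists (H `&` K) => //; exact: fin_index_setI. Qed.

HB.instance Definition _ := isLinearTopological.Build (profinite G)
  profinite_base_neq0 profinite_base_subgroup profinite_base_setI.

End Profinite.

Definition natural (G : zmodType) : Type := G.
HB.instance Definition _ (G : zmodType) := GRing.Zmodule.on (natural G).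

Section Natural.
Variable G : zmodType.

Definition natural_base : set (set (natural G)) :=
  [set multiples (natural G) m | m in [set m | (0 < m)%N]].

Lemma natural_base_neq0 : natural_base !=set0.
Proof. by exists (multiples (natural G) 1), 1%N. Qed.

Lemma natural_base_subgroup (H : set (natural G)) :
  natural_base H -> subgroup H.
Proof. by move=> [m _ <-]; exact: multiples_subgroup. Qed.

Lemma natural_base_setI (H K : set (natural G)) :
  natural_base H -> natural_base K ->
  exists2 L, natural_base L & L `<=` H `&` K.
Proof.
move=> [m /= m0 <-] [n /= n0 <-]; exists (multiples (natural G) (m * n)).
  by exists (m * n)%N; rewrite //= muln_gt0 m0 n0.
move=> _ [x _ <-]; split; last by exists (x *+ m); rewrite -?mulrnA.
by exists (x *+ n); rewrite // -mulrnA mulnC.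
Qed.

HB.instance Definition _ := isLinearTopological.Build (natural G)
  natural_base_neq0 natural_base_subgroup natural_base_setI.

End Natural.

(* The continuous characters of X, as a subset of Hom(X, T). *)
Definition dual (R : realType) (X : topologicalZmodType) :
    set {additive X -> circle R} :=
  [set f | continuous (f : X -> circle R)].
Arguments dual : clear implicits.

(* The embedding of Hom(G/I, V) into Hom(G, V). *)
Definition inflate (G V : zmodType) (I : zmodClosed G)
    (f : {additive Quotient.quot I -> V}) : {additive G -> V} :=
  f \o \pi_(Quotient.quot I).

Section Weights.
Variable X : topologicalType.

Definition nbhs_base (x : X) (B : set (set X)) :=
  B `<=` nbhs x /\ forall U, nbhs x U -> exists2 V, B V & V `<=` U.

(* Cardinals are represented by sets: the minimum cardinality of a base of X
   is the cardinality of K. *)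
Definition has_weight (I : Type) (K : set I) :=
  (exists2 B : set (set X), basis B & B #= K) /\
  forall B : set (set X), basis B -> K #<= B.

Definition has_local_weight (x : X) (I : Type) (K : set I) :=
  (exists2 B : set (set X), nbhs_base x B & B #= K) /\
  forall B : set (set X), nbhs_base x B -> K #<= B.

End Weights.

Lemma coset0 (G : zmodType) (H : set G) : coset 0 H = H.
Proof.
apply/seteqP; split=> [_ [h Hh <-]|h Hh]; first by rewrite add0r.
by exists h; rewrite ?add0r.
Qed.

Lemma profinite_nbhs_base (G : zmodType) :
  nbhs_base (0 : profinite G) (fin_index_subgroups G).
Proof.
split=> [H CH|U [H CH HU]]; first by exists H; rewrite ?coset0.
by exists H => //; rewrite -[H]coset0.
Qed.

Lemma natural_nbhs_base (G : zmodType) :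
  nbhs_base (0 : natural G) [set multiples G m | m in [set m | (0 < m)%N]].
Proof.
split=> [H CH|U [H CH HU]]; first by exists H; rewrite ?coset0.
by exists H => //; rewrite -[H]coset0.
Qed.

(* Main.v *)
Require Import Defs.
From HB Require Import structures.
From mathcomp Require Import all_boot all_order all_algebra.
From mathcomp Require Import generic_quotient ring_quotient.
From mathcomp Require Import boolp classical_sets functions cardinality reals.
From mathcomp Require Import topology normedtype tvs.

Set Implicit Arguments.
Unset Strict Implicit.
Unset Printing Implicit Defensive.

From mathcomp Require Import intdiv lra.
Import Order.TTheory GRing.Theory Num.Theory.
Import numFieldNormedType.Exports.
Local Open Scope classical_set_scope.
Local Open Scope ring_scope.
Local Open Scope quotient_scope.
Local Open Scope card_scope.

(** A character [f] is torsion iff it kills some [mG], iff its kernel has finite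
index (the [m]-torsion of T is finite); since T has no small subgroups, a
character continuous for either topology kills a basic subgroup.

For the cardinalities, [H |-> H^perp] is an injection of C(G) into the finite
sets of torsion characters, because characters extend from subgroups to [G] (T
is divisible), and [f |-> ker f] has finite fibers.  With Hessenberg's theorem
([A * A] embeds in [A] for infinite [A]) this gives [|C(G)| = |t(Hom(G, T))|],
provided C(G) is infinite: otherwise its least element [N] is divisible, as a
character killing [mN] is torsion, hence kills [N].  A base [B] at 0 has at
least [|C(G)|] elements since choosing in each [H] a member of [B] has finite
fibers: only finitely many subgroups contain a given one of finite index. *)

(** * Cardinals *)

Lemma card_le_injfun T U (A : set T) (B : set U) (f : T -> U) :
  (forall x, A x -> B (f x)) ->
  (forall x y, A x -> A y -> f x = f y -> x = y) -> A #<= B.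
Proof.
move=> fAB fI.
have [g] : $|{injfun A >-> B}|.
  apply/injfunPex; exists f => // x y /set_mem Ax /set_mem Ay; exact: fI.
exact: inj_card_le g.
Qed.

Lemma card_le_ex_injfun T U (u0 : U) (A : set T) (B : set U) :
  A #<= B -> exists f : T -> U, (forall x, A x -> B (f x)) /\
    (forall x y, A x -> A y -> f x = f y -> x = y).
Proof.
elim/Ppointed: U => U in u0 B *; first by case: (no u0).
move=> /pcard_leP/injfunPex[f fAB fI]; exists f; split=> // x y Ax Ay.
by apply: fI; exact: mem_set.
Qed.

(** Zorn's lemma for partial injections from [A] to [B], encoded by their graphs. If a maximal one
    missed both a point [a] of [A] and a point [b] of [B], the pair [(a, b)] could be added to
    it. *)
Lemma card_le_total T U (A : set T) (B : set U) : A #<= B \/ B #<= A.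
Proof.
pose P (Z : set (T * U)) := [/\ forall p, Z p -> A p.1 /\ B p.2,
  forall x y y', Z (x, y) -> Z (x, y') -> y = y' &
  forall x x' y, Z (x, y) -> Z (x', y) -> x = x'].
have [F FP Ftot|Z [[ZAB Zf Zi] Zmax]] := @Zorn_bigcup _ P.
  have common p q : (\bigcup_(X in F) X) p -> (\bigcup_(X in F) X) q ->
      exists2 X, P X & X p /\ X q.
    move=> [X FX Xp] [Y FY Yq]; have [XY|YX] := Ftot _ _ FX FY.
      by exists Y; [exact: FP | split=> //; exact: XY].
    by exists X; [exact: FP | split=> //; exact: YX].
  split=> [p [X /FP[XAB _ _] /XAB]//|x y y' Zxy Zxy'|x x' y Zxy Zxy'].
    by have [X [_ Xf _] []] := common _ _ Zxy Zxy'; exact: Xf.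
  by have [X [_ _ Xi] []] := common _ _ Zxy Zxy'; exact: Xi.
have [domA|/existsNP[a /not_implyP[Aa aZ]]] :=
    pselect (forall x, A x -> exists y, Z (x, y)).
  have [->|/set0P[a Aa]] := eqVneq A set0; first by left; exact: card_ge0.
  have [u _] := domA _ Aa.
  have [f fZ] : {f & forall x, A x -> Z (x, f x)}.
    apply: (@choice _ _ (fun x y => A x -> Z (x, y))) => x.
    by have [/domA[y]|?] := pselect (A x); [exists y | exists u].
  left; apply: (card_le_injfun (f := f)) => [x /fZ/ZAB[]//|x y Ax Ay fxy].
  by apply: (Zi _ _ (f y)); [rewrite -fxy|]; exact: fZ.
have [imB|/existsNP[b /not_implyP[Bb bZ]]] :=
    pselect (forall y, B y -> exists x, Z (x, y)).
  have [f fZ] : {f & forall y, B y -> Z (f y, y)}.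
    apply: (@choice _ _ (fun y x => B y -> Z (x, y))) => y.
    by have [/imB[x]|?] := pselect (B y); [exists x | exists a].
  right; apply: (card_le_injfun (f := f)) => [x /fZ/ZAB[]//|x y Bx By fxy].
  by apply: (Zf (f y)); [rewrite -fxy|]; exact: fZ.
exfalso; apply: (Zmax (Z `|` [set (a, b)])).
  split; first by left.
  by move=> /(_ (a, b) (or_intror erefl)) Zab; apply: aZ; exists b.
split=> [p [/ZAB//|->//]|x y y' [Zxy|[xa yb]] [Zxy'|[xa' yb']]|].
- exact: Zf Zxy Zxy'.
- by case: aZ; exists y; rewrite -xa'.
- by case: aZ; exists y'; rewrite -xa.
- by rewrite yb yb'.
move=> x x' y [Zxy|[xa yb]] [Zxy'|[xa' yb']].
- exact: Zi Zxy Zxy'.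
- by case: bZ; exists x; rewrite -yb'.
- by case: bZ; exists x'; rewrite -yb.
- by rewrite xa xa'.
Qed.

(** * Hessenberg's theorem: an infinite set contains a copy of its square *)

Section InfiniteSquare.
Variables (T : Type) (A : set T).
Hypothesis infA : infinite_set A.

(** The approximations for Zorn's lemma: [p.2] injects the square of [p.1] into [p.1], its values
    elsewhere being arbitrary. The two distinct points will be tags that tell two copies of a set
    apart. *)
Definition pairing_on (p : set T * (T * T -> T)) := [/\ p.1 `<=` A,
  (exists c0 c1, [/\ p.1 c0, p.1 c1 & c0 <> c1]),
  (forall x y, p.1 x -> p.1 y -> p.1 (p.2 (x, y))) &
  (forall x y x' y', p.1 x -> p.1 y -> p.1 x' -> p.1 y' ->
     p.2 (x, y) = p.2 (x', y') -> x = x' /\ y = y')].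

(** The starting point: [A] contains a copy of the naturals, whose pairs are coded by [pickle]. *)
Lemma pairing_on_countable : exists p, pairing_on p.
Proof.
have [a Aa] := infinite_setN0 infA.
have [e [eA eI]] := card_le_ex_injfun a ((infiniteP _).1 infA).
have {}eI i j : e i = e j -> i = j by exact: eI.
have [g ge] : {g & forall i, g (e i) = i}.
  have [g gP] : {g : T -> nat & forall x, range e x -> e (g x) = x}.
    apply: (@choice _ _ (fun x i => range e x -> e i = x)) => x.
    by have [[i _ <-]|?] := pselect (range e x); [exists i | exists 0%N].
  by exists g => i; apply: eI; rewrite gP.
exists (range e, fun p => e (choice.pickle (g p.1, g p.2))); split=> /=.
- by move=> _ [i _ <-]; exact: eA.
- by exists (e 0%N), (e 1%N); split; [exists 0%N|exists 1%N|move=> /eI].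
- by move=> x y _ _; eexists.
move=> _ _ _ _ [i _ <-] [j _ <-] [k _ <-] [l _ <-] /eI.
by rewrite !ge => /(pcan_inj choice.pickleK)[-> ->].
Qed.

(* If [p.1] embeds in its complement in [A], a copy of it in that complement
   can be used to store the new pairs. *)
Lemma pairing_on_extend p : pairing_on p -> p.1 #<= A `\` p.1 ->
  exists q, [/\ pairing_on q, p.1 `<=` q.1, exists2 x, q.1 x & ~ p.1 x &
    forall x y, p.1 x -> p.1 y -> q.2 (x, y) = p.2 (x, y)].
Proof.
case: p => D f [/= DA [c0 [c1 [Dc0 Dc1 c01]]] fD fI].
move=> /(card_le_ex_injfun c0)[j [jA jI]].
have jND x : D x -> ~ D (j x) by move=> /jA[].
pose E := D `|` j @` D.
(* [r] sends a point of [E] to the point of [D] that it is or copies, and the tag [c] tells which;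
   together they determine the point. *)
have [r rP] : {r & forall x, E x -> D (r x) /\ (D x /\ x = r x \/ ~ D x /\ x = j (r x))}.
  apply: (@choice _ _ (fun x y => E x -> D y /\ (D x /\ x = y \/ ~ D x /\ x = j y))) => x.
  have [[Dx|[y Dy yx]]|?] := pselect (E x); last by exists c0.
    by exists x => _; split=> //; left.
  by exists y => _; split=> //; right; rewrite -yx; split=> //; exact: jND.
pose c (x : T) := if `[< D x >] then c0 else c1.
have Dc x : D (c x) by rewrite /c; case: ifP.
have cr x y : E x -> E y -> c x = c y -> r x = r y -> x = y.
  rewrite /c => /rP[_ [[Dx ex]|[Dx ex]]] /rP[_ [[Dy ey]|[Dy ey]]] cxy rxy.
  - by rewrite ex ey.
  - by move: cxy; rewrite (asboolT Dx) (asboolF Dy) => /c01.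
  - by move: cxy; rewrite (asboolT Dy) (asboolF Dx) => /esym/c01.
  - by rewrite ex ey rxy.
(* Old pairs keep their value. A new pair is coded in [D] by its tags and representatives, then
   moved by [j] out of [D], where no old value lies. *)
pose g p := if `[< D p.1 /\ D p.2 >] then f p else
  j (f (f (c p.1, c p.2), f (r p.1, r p.2))).
have gD x y : E x -> E y -> D (f (f (c x, c y), f (r x, r y))).
  by move=> /rP[rx _] /rP[ry _]; apply: (fD); apply: fD.
exists (E, g); split=> /=.
- split=> /=.
  + by move=> x [/DA//|[y /jA[? _] <-]].
  + by exists c0, c1; split=> //; left.
  + move=> x y Ex Ey; rewrite /g /=; case: asboolP => [[Dx Dy]|_].
      by left; exact: fD.
    by right; eexists; [exact: (gD _ _ Ex Ey)|].
  + move=> x y x' y' Ex Ey Ex' Ey'; rewrite /g /=.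
    case: asboolP => [[Dx Dy]|_]; case: asboolP => [[Dx' Dy']|_].
    * exact: fI.
    * move=> e; have := jND _ (gD _ _ Ex' Ey'); rewrite -e.
      by case; exact: fD.
    * move=> e; have := jND _ (gD _ _ Ex Ey); rewrite e.
      by case; exact: fD.
    have [[Dx _] [Dy _]] := (rP _ Ex, rP _ Ey).
    have [[Dx' _] [Dy' _]] := (rP _ Ex', rP _ Ey').
    move=> /(jI _ _ (gD _ _ Ex Ey) (gD _ _ Ex' Ey')).
    move=> /(fI _ _ _ _ (fD _ _ (Dc _) (Dc _)) (fD _ _ Dx Dy)
              (fD _ _ (Dc _) (Dc _)) (fD _ _ Dx' Dy')) [].
    move=> /(fI _ _ _ _ (Dc _) (Dc _) (Dc _) (Dc _)) [cx cy].
    by move=> /(fI _ _ _ _ Dx Dy Dx' Dy') [rx ry]; split; exact: cr.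
- by move=> x Dx; left.
- by exists (j c0); [right; exists c0 | exact: jND].
- by move=> x y Dx Dy; rewrite /g asboolT.
Qed.

(** Take a pairing that is maximal under extension, with domain [D]. By the extension lemma [D] does
    not embed in [A \ D], so by comparability [A \ D] embeds in [D]; then all of [A] embeds in [D]
    and the pairing can be transported. *)
Lemma infinite_pairing : exists f : T -> T -> T,
  (forall x y, A x -> A y -> A (f x y)) /\
  (forall x y x' y', A x -> A y -> A x' -> A y' ->
     f x y = f x' y' -> x = x' /\ y = y').
Proof.
pose S := {p | pairing_on p}.
pose le (p q : S) := `[< (sval p).1 `<=` (sval q).1 /\
  forall x y, (sval p).1 x -> (sval p).1 y -> (sval q).2 (x, y) = (sval p).2 (x, y) >].
have [p0 Pp0] := pairing_on_countable.
have [t|p q r /asboolP[pq1 pq2] /asboolP[qr1 qr2]|F Ftot|[[D f] PD] Dmax] :=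
  @ZL_preorder S (exist _ p0 Pp0) le.
- by apply/asboolP; split.
- apply/asboolP; split; first exact: subset_trans qr1.
  by move=> x y px py; rewrite qr2 ?pq2//; exact: pq1.
- have [->|/set0P[q0 Fq0]] := eqVneq F set0; first by exists (exist _ p0 Pp0).
  pose E := \bigcup_(q in F) (sval q).1.
  have common x y : E x -> E y -> exists2 q, F q & (sval q).1 x /\ (sval q).1 y.
    move=> [q Fq qx] [q' Fq' qy].
    have [/asboolP[qq' _]|/asboolP[qq' _]] := Ftot _ _ Fq Fq'.
      by exists q' => //; split=> //; exact: qq'.
    by exists q => //; split=> //; exact: qq'.
  have [t _] := infinite_setN0 infA.
  (* Members of the chain agree where both are defined, so any member containing both coordinates
     gives the value; [t] is a dummy for the other pairs. *)
  have [g gP] : {g & forall z q, F q -> (sval q).1 z.1 -> (sval q).1 z.2 ->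
      g z = (sval q).2 z}.
    apply: (@choice _ _ (fun z w => forall q, F q -> (sval q).1 z.1 ->
      (sval q).1 z.2 -> w = (sval q).2 z)) => -[x y] /=.
    have [[q [Fq qx qy]]|nq] := pselect (exists q, [/\ F q, (sval q).1 x & (sval q).1 y]).
      exists ((sval q).2 (x, y)) => q' Fq' qx' qy'.
      by have [/asboolP[_ ->]|/asboolP[_ ->]] := Ftot _ _ Fq Fq'.
    by exists t => q Fq qx qy; case: nq; exists q.
  have PE : pairing_on (E, g).
    split=> /=.
    + by move=> x [q _]; have [+ _ _ _] := svalP q; exact.
    + have [_ [c0 [c1 [? ? ?]]] _ _] := svalP q0.
      by exists c0, c1; split=> //; exists q0.
    + move=> x y Ex Ey; have [q Fq [qx qy]] := common _ _ Ex Ey.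
      by rewrite (gP _ q)//; exists q => //; have [_ _ + _] := svalP q; exact.
    + move=> x y x' y' Ex Ey Ex' Ey'.
      have [q Fq [qx qy]] := common _ _ Ex Ey.
      have [q' Fq' [qx' qy']] := common _ _ Ex' Ey'.
      have [r Fr [[rx ry] [rx' ry']]] : exists2 r, F r &
         ((sval r).1 x /\ (sval r).1 y) /\ ((sval r).1 x' /\ (sval r).1 y').
        have [/asboolP[qq' _]|/asboolP[qq' _]] := Ftot _ _ Fq Fq'.
          by exists q' => //; split; split=> //; exact: qq'.
        by exists q => //; split; split=> //; exact: qq'.
      by rewrite !(gP _ r)//; have [_ _ _ +] := svalP r; exact.
  exists (exist _ _ PE) => q Fq; apply/asboolP; split=> /=.
    by move=> x qx; exists q.
  by move=> x y qx qy; exact: gP.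
have [DAD|ADD] := card_le_total D (A `\` D).
  have [q [Pq Dq [x qx Dx] qf]] := pairing_on_extend PD DAD.
  have /asboolP[/(_ x qx)//] : le (exist _ _ Pq) (exist _ _ PD).
  by apply: Dmax; apply/asboolP.
have [/= DA [c0 [c1 [Dc0 Dc1 c01]]] fD fI] := PD.
have [k [kD kI]] := card_le_ex_injfun c0 ADD.
(* The tags [c0] and [c1] keep the images of [D] and of its complement disjoint inside [D]. *)
pose h x := if `[< D x >] then f (c0, x) else f (c1, k x).
have Dk x : A x -> ~ D x -> D (k x) by move=> Ax Dx; exact: kD.
have hD x : A x -> D (h x).
  by rewrite /h => Ax; case: asboolP => Dx; apply: fD => //; exact: Dk.
have hI x y : A x -> A y -> h x = h y -> x = y.
  rewrite /h => Ax Ay; case: asboolP => Dx; case: asboolP => Dy.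
  - by move=> /fI[].
  - by move=> /fI[] //; exact: Dk.
  - by move=> /fI[]//; [exact: Dk|move=> /esym].
  - by move=> /fI[]//; [exact: Dk|exact: Dk|move=> _; exact: kI].
exists (fun x y => f (h x, h y)); split=> [x y Ax Ay|x y x' y' Ax Ay Ax' Ay'].
  by apply: DA; apply: fD; exact: hD.
by move=> /fI[||||? ?]; try exact: hD; split; exact: hI.
Qed.

End InfiniteSquare.

(** Number the points of each fiber by naturals: [x] is determined by [f x] and its number, and this
    pair is coded in [B], which is infinite because [A] is. *)
Lemma card_le_finite_fibers T U (f : T -> U) (A : set T) (B : set U) :
  infinite_set A -> (forall x, A x -> B (f x)) ->
  (forall y, B y -> finite_set [set x | A x /\ f x = y]) -> A #<= B.
Proof.
move=> infA fAB fin.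
have infB : infinite_set B.
  move=> finB; apply: infA; apply: sub_finite_set (bigcup_finite finB fin).
  by move=> x Ax; exists (f x); [exact: fAB | ].
have [b Bb] := infinite_setN0 infB.
have [e [eB eI]] := card_le_ex_injfun b ((infiniteP _).1 infB).
have [p [pB pI]] := infinite_pairing infB.
have [n nI] : {n : U -> T -> nat & forall y, B y ->
    {in [set x | A x /\ f x = y] &, injective (n y)}}.
  apply: (@choice _ _ (fun y n => B y ->
    {in [set x | A x /\ f x = y] &, injective n})) => y.
  have [By|?] := pselect (B y); last by exists (fun=> 0%N).
  have /finite_set_countable/countable_injP[n nI] := fin _ By.
  by exists n.
apply: (card_le_injfun (f := fun x => p (f x) (e (n (f x) x)))).
  by move=> x Ax; apply: pB; [exact: fAB | exact: eB].
move=> x y Ax Ay /pI[]; try by [exact: fAB | exact: eB].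
move=> fxy; rewrite fxy => /eI nxy.
by apply: (nI (f y)); [exact: fAB|exact: mem_set|exact: mem_set|exact: nxy].
Qed.

Lemma card_le_finite_subsets T (A : set T) : infinite_set A ->
  [set S : set T | finite_set S /\ S `<=` A] #<= A.
Proof.
elim/Peq: T => T in A *; move=> infA.
have [b Ab] := infinite_setN0 infA.
have [e [eA eI]] := card_le_ex_injfun b ((infiniteP _).1 infA).
have [p [pA pI]] := infinite_pairing infA.
have [l lP] : {l : set T -> seq T & forall S, finite_set S -> S = [set` l S]}.
  apply: (@choice _ _ (fun S l => finite_set S -> S = [set` l])) => S.
  by have [/finite_seqP[s ->]|?] := pselect (finite_set S); [exists s | exists [::]].
(* Iterated pairing is injective only on lists of equal length, so the length of the list is stored
   separately, through the copy [e] of the naturals. *)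
pose code := foldr p b.
have codeA (s : seq T) : [set` s] `<=` A -> A (code s).
  elim: s => //= x s IH sA; apply: pA; first by apply: sA; rewrite /= mem_head.
  by apply: IH => y ys; apply: sA; rewrite /= inE orbC ys.
have codeI (s s' : seq T) : [set` s] `<=` A -> [set` s'] `<=` A ->
    size s = size s' -> code s = code s' -> s = s'.
  elim: s s' => [|x s IH] [|x' s']//= sA sA' [ss'].
  have tailA z (u : seq T) : [set` z :: u] `<=` A -> [set` u] `<=` A.
    by move=> uA y yu; apply: uA; rewrite /= inE yu orbT.
  have [Ax Ax'] : A x /\ A x' by split; [apply: sA|apply: sA']; rewrite /= mem_head.
  move: (tailA _ _ sA) (tailA _ _ sA') => {}sA {}sA'.
  by move=> /pI[]//; try exact: codeA; move=> -> /IH ->.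
apply: (card_le_injfun (f := fun S => p (e (size (l S))) (code (l S)))).
  by move=> S [/lP Sl SA]; apply: pA; [exact: eA | apply: codeA; rewrite -Sl].
move=> S S' [/lP Sl SA] [/lP Sl' SA'] /pI[]; try exact: eA.
- by apply: codeA; rewrite -Sl.
- by apply: codeA; rewrite -Sl'.
move=> /eI ss cs; suff ll' : l S = l S' by rewrite Sl ll' -Sl'.
by apply: codeI; rewrite -?Sl -?Sl'//; exact: ss.
Qed.

Lemma finite_set_subsets T (A : set T) :
  finite_set A -> finite_set [set S | S `<=` A].
Proof.
elim/Peq: T => T in A *; move=> /finite_seqP[s ->].
pose F (m : (size s).-tuple bool) : set T := [set` mask m s].
apply: (@sub_finite_set _ _ (F @` setT)); last exact/finite_image/finite_finset.
move=> S Ss; exists (map_tuple (fun x => `[< S x >]) (in_tuple s)) => //.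
apply/seteqP; split=> x; rewrite /F /= -filter_mask mem_filter.
  by move=> /andP[/asboolP].
by move=> Sx; rewrite asboolT//=; exact: Ss.
Qed.

(** * The circle *)

Section Circle.
Variable R : realType.
Definition circle_pi (x : R) : circle R := \pi_(Quotient.quot (integers R)) x.

Lemma circle_pi_is_zmod_morphism : zmod_morphism circle_pi.
Proof. exact: (@raddfB _ _ (\pi_(Quotient.quot (integers R)))). Qed.
HB.instance Definition _ :=
  GRing.isZmodMorphism.Build R (circle R) circle_pi circle_pi_is_zmod_morphism.

Lemma circle_pi_surj (t : circle R) : exists x, circle_pi x = t.
Proof. exists (repr (t : Quotient.quot (integers R))). exact: reprK. Qed.

Lemma circle_piMn x n : circle_pi (x *+ n) = circle_pi x *+ n :> circle R.
Proof. exact: raddfMn. Qed.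

Lemma circle_pi_eq x y : circle_pi x = circle_pi y <-> x - y \is a Num.int.
Proof.
have xyE := Quotient.idealrBE (integers R) x y; split=> [e|xyZ].
  by rewrite -[_ \is a _]/(x - y \in integers R) xyE; apply/eqP.
by move: (xyZ); rewrite -[_ \is a _]/(x - y \in integers R) xyE => /eqP.
Qed.

Lemma circle_pi_eq0 x : circle_pi x = 0 <-> x \is a Num.int.
Proof. by rewrite -[x in X in _ <-> X]subr0 -circle_pi_eq raddf0. Qed.

Lemma circle_divisible (t : circle R) n : (0 < n)%N -> exists u, u *+ n = t.
Proof.
move=> n0; have [x <-] := circle_pi_surj t; exists (circle_pi (x / n%:R)).
by rewrite -circle_piMn -(mulr_natr (_ / _)) divfK// pnatr_eq0 -lt0n.
Qed.

Lemma circle_torsion_neq0 n : (1 < n)%N ->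
  exists2 t : circle R, t <> 0 & t *+ n = 0.
Proof.
move=> n1; have n0 : n%:R != 0 :> R by rewrite pnatr_eq0 -lt0n ltnW.
exists (circle_pi n%:R^-1).
  move=> /circle_pi_eq0/norm_intr_ge1/(_ (invr_neq0 n0)).
  by rewrite normfV ger0_norm ?ler0n// invf_ge1 ?ltr0n ?(ltnW n1)// lern1 leqNgt n1.
by rewrite -circle_piMn -(mulr_natr (_^-1)) mulVf//; apply/circle_pi_eq0.
Qed.

Lemma circle_torsion_finite m : (0 < m)%N ->
  finite_set [set t : circle R | t *+ m = 0].
Proof.
move=> m0; have mN0 : m%:R != 0 :> R by rewrite pnatr_eq0 -lt0n.
apply: (@sub_finite_set _ _ ((fun i => circle_pi (i%:R / m%:R)) @` `I_m)); last first.
  by apply: finite_image; exact: finite_II.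
move=> t; have [x <-] := circle_pi_surj t.
rewrite /= -circle_piMn => /circle_pi_eq0; rewrite -(mulr_natr x) => /intrP[k xk].
(* Here [x] equals [k / m], and subtracting the integer quotient of [k] by [m] leaves its class
   unchanged. *)
exists `|(k %% m)%Z|%N.
  by rewrite /= -ltz_nat gez0_abs ?modz_ge0 ?ltz_pmod ?eqz_nat -?lt0n.
have absr : `|(k %% m)%Z|%:R = (k %% m)%Z%:~R :> R.
  by rewrite pmulrn gez0_abs// modz_ge0 ?eqz_nat -?lt0n.
have kE : k%:~R = (k %/ m)%Z%:~R * m%:R + (k %% m)%Z%:~R :> R.
  by rewrite {1}(divz_eq k m) intrD intrM.
apply/circle_pi_eq; rewrite (_ : _ - x = - (k %/ m)%Z%:~R) ?rpredN ?intr_int//.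
apply: (mulIf mN0); rewrite mulrBl divfK// absr xk kE.
by rewrite opprD addrCA subrr addr0 mulNr.
Qed.

(** [U] is the image of the open interval of radius 1/4. If all multiples of the class of [r] stay
    in [U], the real multiples of [r] themselves stay below 1/4 in absolute value, so [r] is 0 by
    the Archimedean property. *)
Lemma circle_no_small_subgroups :
  exists2 U, nbhs (0 : circle R) U &
    forall t, (forall n, U (t *+ n)) -> t = 0.
Proof.
pose U := circle_pi @` [set r | `|r| < 4^-1].
have U0 : U 0 by exists 0; rewrite ?raddf0//= normr0 invr_gt0.
exists U.
  apply: open_nbhs_nbhs; split => //.
  rewrite /open/= /quotient_open.
  (* The saturation of the interval: its translates by all integers. *)
  rewrite (_ : _ @^-1` _ = \bigcup_(k : int) ball (k%:~R : R) 4^-1).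
    by apply: bigcup_open => k _; exact: ball_open.
  apply/seteqP; split=> x /=.
    move=> [r r4] /circle_pi_eq/intrP[k rxk]; exists (- k) => //.
    by rewrite /ball/= mulrNz distrC opprK -[_ *~ _]rxk addrC subrK.
  move=> [k _]; rewrite /ball/= distrC => xk; exists (x - k%:~R) => //.
  by apply/circle_pi_eq; rewrite addrAC subrr add0r rpredN intr_int.
move=> t tU; have [r /= r4 rt] := tU 1%N.
have kr n : `|r *+ n| < 4^-1.
  elim: n => [|n IHn]; first by rewrite normr0 invr_gt0.
  have [s /= s4 st] := tU n.+1.
  suff -> : r *+ n.+1 = s by [].
  (* The difference is an integer of absolute value below 1/4 + 1/4 + 1/4, hence 0. *)
  apply/eqP; rewrite -subr_eq0; apply: contraT => rs0.
  have /norm_intr_ge1/(_ rs0) : r *+ n.+1 - s \is a Num.int.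
    by apply/circle_pi_eq; rewrite circle_piMn rt st mulr1n.
  have := ler_normB (r *+ n.+1) s; have := ler_normD r (r *+ n).
  by rewrite mulrS; lra.
suff r0 : r = 0 by rewrite -[t]mulr1n -rt r0 raddf0.
apply: contrapT => /eqP; rewrite -normr_gt0 => r0.
have rn : 1 < `|r| * (Num.bound `|r|^-1)%:R.
  by rewrite -ltr_pdivrMl// mulr1 archi_boundP// invr_ge0.
by have := kr (Num.bound `|r|^-1); rewrite normrMn -[_ *+ _]mulr_natr; lra.
Qed.

End Circle.

(** * Finite-index subgroups and torsion characters *)

Section Groups.
Variable G : zmodType.
Implicit Types H K : set G.

Lemma subgroupMn H x n : subgroup H -> H x -> H (x *+ n).
Proof.
move=> sH Hx; elim: n => [|n IHn]; first exact: sH.1.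
by rewrite mulrS; exact: subgroupD.
Qed.

Lemma subgroupMz H x (n : int) : subgroup H -> H x -> H (x *~ n).
Proof.
move=> sH Hx; case: n => n; first exact: subgroupMn.
by rewrite NegzE mulrNz; apply: subgroupN => //; exact: subgroupMn.
Qed.

Lemma coset_id H x : subgroup H -> coset x H x.
Proof. by move=> sH; exists 0; [exact: sH.1 | rewrite addr0]. Qed.

Lemma coset_inj H x y : subgroup H -> coset x H = coset y H -> H (x - y).
Proof.
move=> sH xy; have : coset y H x by rewrite -xy; exact: coset_id.
by move=> [h Hh <-]; rewrite addrC addKr.
Qed.

(** Induction on a list of cosets: the exponent is multiplied by some [n] that brings a
    representative [y] of the new coset into [H]. *)
Lemma finite_index_exponent H : subgroup H -> finite_index H ->
  exists2 m, (0 < m)%N & forall x, H (x *+ m).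
Proof.
move=> sH fH; have [s sE] := (finite_seqP _).1 fH.
suff [m m0 mP] : exists2 m, (0 < m)%N & forall x, coset x H \in s -> H (x *+ m).
  exists m => // x; apply: mP.
  have : [set coset x H | x in setT] (coset x H) by exists x.
  by rewrite sE.
elim: s {sE} => [|c s [m m0 IHm]]; first by exists 1%N.
have [[y cy]|nc] := pselect (exists y, coset y H = c); last first.
  exists m => // x; rewrite inE => /orP[/eqP cx|]; last exact: IHm.
  by case: nc; exists x.
(* Otherwise the multiples of [y] would lie in pairwise distinct cosets. *)
have [n n0 yn] : exists2 n, (0 < n)%N & H (y *+ n).
  apply: contrapT => ny; apply: infinite_nat.
  apply: (card_le_finite _ fH).
  apply: (card_le_injfun (f := fun n => coset (y *+ n) H)).
    by move=> n _; exists (y *+ n).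
  suff lt_neq i j : (i < j)%N -> coset (y *+ i) H <> coset (y *+ j) H.
    by move=> i j _ _ ij; case: (ltngtP i j) => [/lt_neq//|/lt_neq/nesym//|].
  move=> ij /esym/(coset_inj sH); rewrite -mulrnBr ?(ltnW ij)// => Hy.
  by apply: ny; exists (j - i)%N; rewrite ?subn_gt0.
exists (n * m)%N => [|x]; first by rewrite muln_gt0 n0.
rewrite inE => /orP[/eqP cx|/IHm xm]; last by rewrite mulnC mulrnA; exact: subgroupMn.
rewrite mulrnA; apply: subgroupMn => //; rewrite -[x](subrK y) mulrnDl.
apply: subgroupD => //; apply: subgroupMn => //.
by apply: coset_inj => //; rewrite cx cy.
Qed.

Lemma finite_index_sub H K : subgroup H -> subgroup K -> H `<=` K ->
  finite_index H -> finite_index K.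
Proof.
move=> sH sK HK fH; pose F S : set G := [set s + k | s in S & k in K].
apply: (@sub_finite_set _ _ (F @` [set coset x H | x in setT])); last exact: finite_image.
move=> _ [x _ <-]; exists (coset x H); first by exists x.
apply/seteqP; split=> [_ [_ [h /HK Kh <-] [k Kk <-]]|_ [k Kk <-]].
  by exists (h + k); [exact: subgroupD | rewrite addrA].
by exists (x + 0); [exists 0; first exact: sH.1 | exists k; rewrite ?addr0].
Qed.

(** An overgroup of [H] is determined by the set of cosets of [H] that it contains. *)
Lemma finite_overgroups H : subgroup H -> finite_index H ->
  finite_set [set K | subgroup K /\ H `<=` K].
Proof.
move=> sH /finite_set_subsets; apply: card_le_finite.
apply: (card_le_injfun (f := fun K => [set coset x H | x in K])).
  by move=> K _ _ [x _ <-]; exists x.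
suff sub K L : subgroup L -> H `<=` L ->
    [set coset x H | x in K] = [set coset x H | x in L] -> K `<=` L.
  by move=> K L [sK HK] [sL HL] KL; apply/seteqP; split; apply: sub.
move=> sL HL KL x Kx; have : [set coset x H | x in K] (coset x H) by exists x.
rewrite KL => -[y Ly /esym/(coset_inj sH)/HL Lxy].
by rewrite -(subrK y x); exact: subgroupD.
Qed.

(** Applied to an enumeration of all finite-index subgroups, if there are finitely many, this yields
    the least one. *)
Lemma fin_index_bound (s : seq (set G)) : [set` s] `<=` fin_index_subgroups G ->
  exists2 N, fin_index_subgroups G N & forall H, H \in s -> N `<=` H.
Proof.
elim: s => [_|H s IHs Hs]; first by exists setT => //; exact: fin_index_setT.
have [|N CN Ns] := IHs; first by move=> K Ks; apply: Hs; rewrite /= inE orbC Ks.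
exists (H `&` N); first by apply: fin_index_setI => //; apply: Hs; rewrite /= mem_head.
by move=> K; rewrite inE => /orP[/eqP->|/Ns NK] x []// _ /NK.
Qed.

End Groups.

Lemma pair_mulrz (U V : zmodType) (x : U) (y : V) (n : int) :
  (x, y) *~ n = (x *~ n, y *~ n).
Proof. by rewrite [LHS]surjective_pairing !raddfMz. Qed.

Lemma hom_mulrnE (U V : zmodType) (f : {additive U -> V}) n x :
  (f *+ n) x = f x *+ n.
Proof. by elim: n => [|n IHn]; rewrite ?mulr0n// !mulrS -IHn. Qed.

Lemma torsion_homP (U V : zmodType) (f : {additive U -> V}) :
  torsion {additive U -> V} f <->
  exists2 m, (0 < m)%N & forall x, f x *+ m = 0.
Proof.
split=> -[m m0 fm]; exists m => //.
  by move=> x; rewrite -hom_mulrnE fm.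
by apply: additive_eqP => x; rewrite hom_mulrnE fm.
Qed.

Lemma factor_quot (G V : zmodType) (I : zmodClosed G) (f : {additive G -> V}) :
  (forall x, x \in I -> f x = 0) ->
  exists g : {additive Quotient.quot I -> V}, inflate g = f.
Proof.
move=> fI; pose g (q : Quotient.quot I) := f (repr q).
have fE x y : x = y %[mod Quotient.quot I] -> f x = f y.
  move=> /eqP; rewrite -Quotient.idealrBE => /fI/eqP.
  by rewrite raddfB subr_eq0 => /eqP.
have gB : zmod_morphism g.
  by move=> p q; rewrite /g -raddfB; apply: fE; rewrite !raddfB/= !reprK.
pose gM := GRing.isZmodMorphism.Build _ _ g gB.
pose ga : {additive Quotient.quot I -> V} := HB.pack g gM.
exists ga; apply: additive_eqP => x /=.
by rewrite /g; apply: fE; rewrite reprK.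
Qed.

(** * Characters into a divisible group with finite, nontrivial torsion parts *)

Section Characters.
Variables (G V : zmodType).
Hypothesis V_divisible : forall (t : V) n, (0 < n)%N -> exists u, u *+ n = t.
Hypothesis V_torsion_neq0 : forall n, (1 < n)%N ->
  exists2 t : V, t <> 0 & t *+ n = 0.
Hypothesis V_torsion_finite : forall m, (0 < m)%N ->
  finite_set [set t : V | t *+ m = 0].
Local Notation hom := {additive G -> V}.
Implicit Types (H K : set G) (f g : hom).

Definition annihilator H : set hom := [set f | forall x, H x -> f x = 0].

(** The cosets of the kernel are fibers of [f], and the values of [f] lie in the finite
    [m]-torsion. *)
Lemma fin_index_kernel f : torsion hom f ->
  fin_index_subgroups G (f @^-1` [set 0]).
Proof.
move=> /torsion_homP[m m0 fm]; split.
  by split=> [|x y]; rewrite /= ?raddf0// raddfB => -> ->; rewrite subr0.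
apply: (@sub_finite_set _ _ ((fun t : V => f @^-1` [set t]) @` [set t | t *+ m = 0])).
  move=> _ [x _ <-]; exists (f x) => //=.
  apply/seteqP; split=> [y fy|_ [h /= fh <-]]; last by rewrite /= raddfD fh addr0.
  by exists (y - x); rewrite /= ?raddfB ?fy ?subrr// addrC subrK.
exact/finite_image/V_torsion_finite.
Qed.

Lemma torsion_annihilator H : fin_index_subgroups G H ->
  annihilator H `<=` torsion hom.
Proof.
move=> [sH fH] f fH0; apply/torsion_homP.
have [m m0 mH] := finite_index_exponent sH fH; exists m => // x.
by rewrite -raddfMn fH0.
Qed.

(** Such an [f] is determined by the graph of the map it induces on the cosets of [H], a subset of
    the finite product of the coset set with the [m]-torsion of [V]. *)
Lemma finite_annihilator H : fin_index_subgroups G H -> finite_set (annihilator H).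
Proof.
move=> [sH fH]; have [m m0 mH] := finite_index_exponent sH fH.
have := finite_setX fH (V_torsion_finite m0).
move=> /finite_set_subsets; apply: card_le_finite.
apply: (card_le_injfun (f := fun f : hom => [set (coset x H, f x) | x in setT])).
  move=> f fH0 _ [x _ <-]; split=> /=; first by exists x.
  by rewrite -raddfMn fH0.
move=> f g _ gH0 fg; apply: additive_eqP => x.
have : [set (coset x H, f x) | x in setT] (coset x H, f x) by exists x.
rewrite fg => -[y _ [/(coset_inj sH)/gH0 + <-]].
by rewrite raddfB => /subr0_eq.
Qed.

(** A homomorphism from a subgroup of [G] to [V], given by its graph; for a subgroup of the product,
    single-valuedness need only be tested at 0. *)
Definition graph_of_hom (Z : set (G * V)) :=
  subgroup Z /\ forall t, Z (0, t) -> t = 0.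

(* The value at [x] may be any [t] with [t *+ d = s], where [d > 0] is least such
   that [(x *+ d, s)] lies in the graph; adding a [d]-torsion element makes it
   nonzero. *)
Lemma graph_value (Z : set (G * V)) x : graph_of_hom Z ->
  exists2 t : V, (forall (n : int) s, Z (x *~ n, s) -> s = t *~ n) &
    ((forall s, ~ Z (x, s)) -> t <> 0).
Proof.
move=> [sZ Z0].
pose P n := `[< (0 < n)%N /\ exists s, Z (x *+ n, s) >].
(* With no positive multiple of [x] in the domain there is no constraint on [t], and any nonzero
   element will do. *)
have [exP|nP] := pselect (exists n, P n); last first.
  have [t t0 _] := V_torsion_neq0 (isT : (1 < 2)%N).
  exists t => [n s Zns|_]; last exact: t0.
  have absn : (`|n|%N = 0)%N.
    apply: contra_notP nP => /eqP; rewrite -lt0n => n0; exists `|n|%N.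
    apply/asboolP; split=> //; case: n Zns {n0} => n Zns; first by exists s.
    exists (- s); move: (subgroupN sZ Zns).
    by rewrite NegzE mulrNz -[- (_, _)]/(- - _, - _) opprK.
  move: Zns; rewrite (_ : n = 0) ?mulr0z; last by apply/eqP; rewrite -absz_eq0 absn.
  by move=> /Z0.
case: (ex_minnP exP) => d /asboolP[d0 [s0 Zs0]] dmin.
(* By division with remainder and minimality, [d] divides every [n] such that [x *~ n] is in the
   domain. *)
have main t : t *+ d = s0 -> forall (n : int) s, Z (x *~ n, s) -> s = t *~ n.
  move=> td n s Zns.
  have dN0 : (d : int) != 0 by rewrite eqz_nat -lt0n.
  have Zr : Z (x *~ (n %% d)%Z, s - t *~ ((n %/ d)%Z * d)).
    have := sZ.2 _ _ Zns (subgroupMz (n %/ d)%Z sZ Zs0).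
    have zq (U : zmodType) (y : U) : y *~ ((n %/ d)%Z * d) = y *+ d *~ (n %/ d)%Z.
      by rewrite mulrC mulrzA.
    by congr Z; rewrite pair_mulrz /modz !mulrzBr !zq td.
  have r0 : (n %% d)%Z = 0.
    apply/eqP; rewrite -absz_eq0 -leqn0 leqNgt; apply/negP => r0.
    have /dmin : P `|(n %% d)%Z|%N.
      apply/asboolP; split=> //; eexists; move: Zr.
      by rewrite -{1}[(n %% d)%Z]gez0_abs ?modz_ge0//; exact.
    by rewrite leqNgt -ltz_nat gez0_abs ?modz_ge0// ltz_pmod.
  move: Zr; rewrite r0 mulr0z => /Z0/eqP; rewrite subr_eq0 => /eqP ->.
  by rewrite [in RHS](divz_eq n d) r0 addr0.
have [t td] := V_divisible s0 d0.
have [t0|tn0] := pselect (t = 0); last by exists t => //; exact: main.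
(* If [d] is 1, then [x] is already in the domain and its value need not be nonzero. *)
have [d1|d1] := eqVneq d 1%N.
  exists t; first exact: main.
  by move=> /(_ s0); move: Zs0; rewrite d1.
have [|u u0 ud] := V_torsion_neq0 (_ : (1 < d)%N).
  by case: d d0 d1 {main td dmin Zs0} => [|[]].
by exists u => [n s|//]; apply: main; rewrite ud -td t0 mul0rn.
Qed.

(** Adjoin the cyclic group generated by [(x, t)]; the condition on [t] in [graph_value] is what
    keeps the sum single-valued. *)
Lemma graph_extend (Z : set (G * V)) x : graph_of_hom Z ->
  exists2 Y, graph_of_hom Y /\ Z `<=` Y &
    exists2 t : V, Y (x, t) & ((forall s, ~ Z (x, s)) -> t <> 0).
Proof.
move=> gZ; have [t tP t0] := graph_value x gZ; have [sZ Z0] := gZ.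
pose v : G * V := (x, t).
exists [set p | exists n : int, Z (p - v *~ n)]; last first.
  exists t => //; exists 1; rewrite mulr1z subrr; exact: sZ.1.
split; last by move=> p Zp; exists 0; rewrite mulr0z subr0.
split.
  split=> [|p q [n Zp] [m Zq]]; first by exists 0; rewrite mulr0z subr0; exact: sZ.1.
  exists (n - m); have := sZ.2 _ _ Zp Zq; congr Z.
  by rewrite mulrzBr !opprD !opprK addrACA.
move=> s [n].
have -> : (0, s) - v *~ n = (x *~ (- n), s - t *~ n).
  by rewrite pair_mulrz mulrNz -[_ - _]/(0 - _, s - _) sub0r.
by move=> /tP; rewrite mulrNz => /eqP; rewrite subr_eq addNr => /eqP.
Qed.

Lemma character_extend (Z : set (G * V)) : graph_of_hom Z ->
  exists f : hom, forall x t, Z (x, t) -> f x = t.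
Proof.
move=> gZ.
pose P (Y : set (G * V)) := Y = set0 \/ graph_of_hom Y /\ Z `<=` Y.
have [F FP Ftot|Y [PY Ymax]] := @Zorn_bigcup _ P.
  have [F0|/existsNP[X0 /not_implyP[FX0 X00]]] := pselect (forall X, F X -> X = set0).
    by left; apply/seteqP; split=> // p [X /F0 ->].
  have good X p : F X -> X p -> graph_of_hom X /\ Z `<=` X.
    by move=> /FP[->//|].
  have [p0 X0p] : X0 !=set0 by apply/set0P/eqP.
  have [[[X0_0 _] _] ZX0] := good _ _ FX0 X0p.
  right; split; last by move=> z /ZX0; exists X0.
  split; last by move=> t [X FX Xt]; have [[_ X_func] _] := good _ _ FX Xt; exact: X_func.
  split; first by exists X0.
  move=> p q [X FX Xp] [X' FX' X'q].
  have [[[sX _] _] [[sX' _] _]] := (good _ _ FX Xp, good _ _ FX' X'q).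
  have [XX'|X'X] := Ftot _ _ FX FX'.
    by exists X' => //; apply: sX'.2 => //; exact: XX'.
  by exists X => //; apply: sX.2 => //; exact: X'X.
have [Y0|[gY ZY]] := PY.
  case: (Ymax Z); last by right; split.
  rewrite Y0; split; first exact: sub0set.
  by move=> /(_ _ gZ.1.1).
have [sY Y0] := gY.
have fex x : exists t, Y (x, t).
  apply: contrapT => /forallNP nY.
  have [W [gW YW] [t Wt _]] := graph_extend x gY.
  apply: (Ymax W); last by right; split=> //; exact: subset_trans YW.
  by split=> // /(_ _ Wt); exact: nY.
have Yfun x s t : Y (x, s) -> Y (x, t) -> s = t.
  move=> Ys Yt; have : Y (0, s - t).
    by have := sY.2 _ _ Ys Yt; rewrite -[_ - _]/(x - x, s - t) subrr.
  by move=> /Y0/eqP; rewrite subr_eq0 => /eqP.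
have [f fY] := choice fex.
have fB : zmod_morphism f.
  by move=> x y; apply: Yfun (fY _) _; exact: (sY.2 _ _ (fY x) (fY y)).
pose fM := GRing.isZmodMorphism.Build _ _ f fB.
pose fa : hom := HB.pack f fM.
by exists fa => x t /ZY; exact: Yfun.
Qed.

(** Extend the zero character of [K] to [x] with a nonzero value, then to all of [G]. *)
Lemma character_separation K x : subgroup K -> ~ K x ->
  exists2 f, annihilator K f & f x <> 0.
Proof.
move=> sK Kx; pose Z : set (G * V) := [set p | K p.1 /\ p.2 = 0].
have gZ : graph_of_hom Z.
  split; last by move=> t [].
  split; first by split=> //; exact: sK.1.
  move=> [a s] [b t] [/= Ka ->] [/= Kb ->]; split; first exact: sK.2.
  by rewrite /= subr0.
have [Y [gY ZY] [t Yt t0]] := graph_extend x gZ.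
have [f fY] := character_extend gY.
exists f; last by rewrite (fY _ _ Yt); apply: t0 => s [].
by move=> y Ky; apply: fY; apply: ZY.
Qed.

Lemma annihilator_inj H K : subgroup H -> subgroup K ->
  annihilator H = annihilator K -> H = K.
Proof.
suff sub H' K' : subgroup K' -> annihilator H' = annihilator K' -> H' `<=` K'.
  by move=> sH sK HK; apply/seteqP; split; apply: sub.
move=> sK HK x Hx; apply: contrapT => /(character_separation sK)[f].
by rewrite -HK => /(_ x Hx) ->.
Qed.

Lemma infinite_fin_index_subgroups : ~ almost_divisible G ->
  infinite_set (fin_index_subgroups G).
Proof.
move=> nG finC; apply: nG; have [s sE] := (finite_seqP _).1 finC.
have [|N CN sN] := @fin_index_bound G s; first by rewrite sE.
have {}sN H : fin_index_subgroups G H -> N `<=` H.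
  by move=> CH; apply: sN; rewrite sE in CH.
have [sG _ maxG] := max_divisibleP G; have [sNG fN] := CN.
(* It suffices that the least finite-index subgroup [N] is divisible: it then lies in
   [max_divisible G], which inherits finite index. *)
apply: (finite_index_sub sNG _ _ fN) => //; apply: maxG => // m x m0 Nx.
apply: contrapT => nx; pose K := [set y *+ m | y in N].
have [||f fK] := @character_separation K x.
- split; first by exists 0; rewrite ?mul0rn//; exact: sNG.1.
  by move=> _ _ [y Ny <-] [z Nz <-]; exists (y - z); rewrite ?mulrnBl//; exact: sNG.2.
- by move=> [y Ny yx]; apply: nx; exists y.
apply; have [k k0 kN] := finite_index_exponent sNG fN.
(* As [k] sends [G] into [N], the product [k * m] sends [G] into [K], which [f] kills. *)
have tf : torsion hom f.
  apply/torsion_homP; exists (k * m)%N; first by rewrite muln_gt0 k0.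
  by move=> y; rewrite -raddfMn; apply: fK; rewrite mulrnA; exists (y *+ k).
exact: sN (fin_index_kernel tf) _ Nx.
Qed.

Lemma card_fin_index_torsion : ~ almost_divisible G ->
  fin_index_subgroups G #= torsion hom.
Proof.
move=> /infinite_fin_index_subgroups infC.
have C_le : fin_index_subgroups G #<=
    [set S : set hom | finite_set S /\ S `<=` torsion hom].
  apply: (card_le_injfun (f := annihilator)).
    by move=> H CH; split; [exact: finite_annihilator | exact: torsion_annihilator].
  by move=> H K [sH _] [sK _]; exact: annihilator_inj.
(* Otherwise the torsion characters would have only finitely many subsets, too few for the
   annihilators. *)
have infT : infinite_set (torsion hom).
  move=> /finite_set_subsets finT; apply: infC; apply: card_le_finite C_le _.
  by apply: sub_finite_set finT => S [].
apply: Cantor_Bernstein; first exact: card_le_trans C_le (card_le_finite_subsets infT).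
apply: (card_le_finite_fibers (f := fun f : hom => f @^-1` [set 0])) => //.
  exact: fin_index_kernel.
move=> H CH; apply: sub_finite_set (finite_annihilator CH).
by move=> f [_ <-] x.
Qed.

End Characters.

(** * The profinite and natural topologies *)

Section Weights.
Variable G : zmodType.
Hypothesis infC : infinite_set (fin_index_subgroups G).

Lemma nbhs_base_fin_index_le (B : set (set (profinite G))) :
  nbhs_base (0 : profinite G) B -> fin_index_subgroups G #<= B.
Proof.
move=> [Bnbhs Bbase].
have /choice[v vP] : forall H : set G, exists V : set G,
    fin_index_subgroups G H -> B V /\ V `<=` H.
  move=> H; have [CH|nCH] := pselect (fin_index_subgroups G H); last by exists setT.
  have [V BV VH] := Bbase H ((profinite_nbhs_base G).1 _ CH).
  by exists V.
apply: (card_le_finite_fibers (f := v)) => //; first by move=> H /vP[].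
(* The neighborhood [V] contains a finite-index [K], so every [H] for which [V] was chosen is an
   overgroup of [K]. *)
move=> V /Bnbhs /(profinite_nbhs_base G).2[K CK KV].
have [sK fK] := CK; apply: sub_finite_set (finite_overgroups sK fK).
move=> H [[sH fH] vH]; split=> //; apply: subset_trans KV _.
by rewrite -vH; have [] := vP H.
Qed.

Lemma has_local_weight_profinite :
  has_local_weight (0 : profinite G) (fin_index_subgroups G).
Proof.
split; last exact: nbhs_base_fin_index_le.
by exists (fin_index_subgroups G); [exact: profinite_nbhs_base | exact: card_eqxx].
Qed.

Definition fin_index_cosets : set (set G) :=
  [set S | exists2 H, fin_index_subgroups G H & exists x, S = coset x H].

Lemma fin_index_subgroups_cosets : fin_index_subgroups G `<=` fin_index_cosets.
Proof. by move=> H CH; exists H => //; exists 0; rewrite coset0. Qed.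

(** Sending a coset to a subgroup of which it is a coset has finite fibers, by finiteness of the
    index. *)
Lemma card_fin_index_cosets : fin_index_cosets #= fin_index_subgroups G.
Proof.
apply: Cantor_Bernstein; last exact: subset_card_le fin_index_subgroups_cosets.
have /choice[h hP] : forall S : set G, exists H : set G, fin_index_cosets S ->
    fin_index_subgroups G H /\ exists x, S = coset x H.
  move=> S; have [[H CH SH]|nS] := pselect (fin_index_cosets S); first by exists H.
  by exists setT.
apply: (card_le_finite_fibers (f := h)).
- move=> finS; apply: infC; apply: sub_finite_set finS.
  exact: fin_index_subgroups_cosets.
- by move=> S /hP[].
move=> H [_ fH]; apply: sub_finite_set fH => S [/hP[_ [x Sx]] hS].
by exists x => //; rewrite [RHS]Sx hS.
Qed.

Lemma basis_fin_index_cosets : basis (fin_index_cosets : set (set (profinite G))).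
Proof.
split=> [_ [H CH [x ->]]|x A [H CH HA]].
  rewrite openE => y [h Hh <-]; exists H => //.
  move=> _ [k Hk <-]; exists (h + k); last by rewrite addrA.
  exact: subgroupD CH.1 Hh Hk.
exists (coset x H) => //; split; last exact: (coset_id x CH.1).
by exists H => //; exists x.
Qed.

Lemma has_weight_profinite :
  has_weight (profinite G) (fin_index_subgroups G).
Proof.
split=> [|B [Bopen Bbase]].
  by exists fin_index_cosets;
    [exact: basis_fin_index_cosets | exact: card_fin_index_cosets].
(* The members of a base that contain 0 form a base at 0, so the local bound applies to them. *)
apply: card_le_trans (subset_card_le (_ : [set U | B U /\ U 0] `<=` B));
  last by move=> U [].
apply: nbhs_base_fin_index_le; split=> [U [BU U0]|U /Bbase[V]]; last by exists V.
by apply: open_nbhs_nbhs; split=> //; exact: Bopen.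
Qed.

End Weights.

(** * Continuous characters and the first Ulm subgroup *)

Section Duals.
Variables (R : realType) (G : zmodType).
Local Notation hom := {additive G -> circle R}.

(** A character killed by [m] is constant on the cosets of [mG]. Conversely, a continuous one maps
    some [mG] to a subgroup inside [U], which is trivial. The profinite case follows the same
    pattern with finite-index subgroups. *)
Lemma dual_natural : dual R (natural G) = torsion hom :> set hom.
Proof.
apply/seteqP; split=> f; last first.
  move=> /torsion_homP[m m0 fm] x A /nbhs_singleton Afx.
  exists (multiples (natural G) m); first by exists m.
  by move=> _ [_ [y _ <-] <-]; rewrite /= raddfD raddfMn fm addr0.
move=> fC; have [U U0 UP] := circle_no_small_subgroups R.
have : nbhs (f 0) U by rewrite raddf0.
move=> /fC[_ [m m0 <-] mU]; apply/torsion_homP; exists m => // x.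
have fMn y k : f (y *+ k) = f y *+ k :> circle R := raddfMn f k y.
apply: UP => n; rewrite -!fMn; apply: mU; exists (x *+ m *+ n); last exact: add0r.
by exists (x *+ n) => //; rewrite -!mulrnA mulnC.
Qed.

Lemma dual_profinite : dual R (profinite G) = torsion hom :> set hom.
Proof.
apply/seteqP; split=> f; last first.
  move=> tf x A /nbhs_singleton Afx; exists (f @^-1` [set 0]).
    exact: (fin_index_kernel (@circle_torsion_finite R) tf).
  by move=> _ [y fy <-]; rewrite /= raddfD fy addr0.
move=> fC; have [U U0 UP] := circle_no_small_subgroups R.
have : nbhs (f 0) U by rewrite raddf0.
move=> /fC[H CH HU]; apply: (torsion_annihilator CH) => x Hx.
have fMn y k : f (y *+ k) = f y *+ k :> circle R := raddfMn f k y.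
apply: UP => n; rewrite -!fMn; apply: HU; exists (x *+ n); last exact: add0r.
exact: subgroupMn CH.1 Hx.
Qed.

(** A character killed by [m] vanishes on [mG], which contains the first Ulm subgroup, so it factors
    through the quotient. *)
Lemma torsion_inflate : torsion hom =
  [set inflate (V := circle R) f | f in
     torsion {additive Quotient.quot (ulm1 G) -> circle R}].
Proof.
apply/seteqP; split=> [f /torsion_homP[m m0 fm]|_ [g /torsion_homP[m m0 gm] <-]].
  have [|g gf] := @factor_quot G (circle R) (ulm1 G) f.
    by move=> x /asboolW/(_ m m0)[y _ <-]; rewrite raddfMn fm.
  exists g => //; apply/torsion_homP; exists m => // q.
  by rewrite -[q]reprK; have := fm (repr q); rewrite -gf.
by apply/torsion_homP; exists m => // x; exact: gm.
Qed.

End Duals.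

Theorem lemma3p2 (R : realType) (G : zmodType) :
  ~ almost_divisible G ->
  [/\ dual R (natural G) = dual R (profinite G)
        :> set {additive G -> circle R},
      dual R (profinite G) = torsion {additive G -> circle R}
        :> set {additive G -> circle R} &
      torsion {additive G -> circle R} =
        [set inflate (V := circle R) f | f in
           torsion {additive Quotient.quot (ulm1 G) -> circle R}]]
  /\
  [/\ has_weight (profinite G) (fin_index_subgroups G),
      has_local_weight (0 : profinite G) (fin_index_subgroups G) &
      fin_index_subgroups G #= torsion {additive G -> circle R}].
Proof.
move=> nG.
have [[div tors] fin] :=
  (@circle_divisible R, @circle_torsion_neq0 R, @circle_torsion_finite R).
have infC := infinite_fin_index_subgroups div tors fin nG.
split; split.
- by rewrite dual_natural dual_profinite.
- exact: dual_profinite.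
- exact: torsion_inflate.
- exact: has_weight_profinite.
- exact: has_local_weight_profinite.
- exact: card_fin_index_torsion.
Qed.
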